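(* Let $\mathcal{B}=(a_1,a_2)\subset\mathbb{R}$, $\tau>0$, and let $\rho_0>0$ and $c$ be constants. Let $I=I(x,t)$ be a $C^2$ function on $\mathcal{B}\times[0,\tau]$ satisfying $$\frac{\partial^2 I}{\partial t^2}-\frac{c}{\rho_0}\frac{\partial^2 I}{\partial x^2}=0,$$ and having compact support on $\mathcal{B}$ (i.e. there is a compact set $K\subset\mathcal{B}$ such that $I(x,t)=0$ for all $x\notin K$ and all $t\in[0,\tau]$). Then $$\Pi(t)=\int_{\mathcal{B}}\frac12\left(\rho_0\left(\frac{\partial I}{\partial t}\right)^2+c\left(\frac{\partial I}{\partial x}\right)^2\right)dx$$ is an integral of motion, that is, $\Pi(t)=\Pi(0)$ for all $t\in[0,\tau]$.
   Context: $I$ is the total energy field of a one-dimensional elastic body with material density $\rho_0$ and constant elastic modulus $c$. *)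

(* Defs.v *)
From HB Require Import structures.
From mathcomp Require Import all_boot all_order all_algebra.
From mathcomp Require Import all_classical all_reals all_analysis.

Set Implicit Arguments.
Unset Strict Implicit.
Unset Printing Implicit Defensive.

Import Order.TTheory GRing.Theory Num.Theory.
Import numFieldNormedType.Exports.

Local Open Scope classical_set_scope.
Local Open Scope ring_scope.

(* Derivatives relative to a set D: two-sided at interior points of D, and
   one-sided at the endpoints when D is a closed interval. *)

Definition derivable_within (R : realType) (D : set R) (f : R -> R) (t : R) :=
  cvg (h^-1 *: (f (h + t) - f t) @[h --> within [set h | D (h + t)] 0^']).

Definition derive_within (R : realType) (D : set R) (f : R -> R) (t : R) : R :=
  lim (h^-1 *: (f (h + t) - f t) @[h --> within [set h | D (h + t)] 0^']).

Lemma within_shift_interior (R : realType) (D : set R) (t : R) :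
  interior D t -> within [set h | D (h + t)] 0^' = 0^'.
Proof.
move=> Dt; have Dt' : (0 : R)^' [set h | D (h + t)].
  by apply: nbhs_dnbhs; have /nbhs0P := Dt; apply: filterS => h; rewrite /= addrC.
apply/seteqP; split=> A HA; last by apply: filterS HA => s As _.
by apply: (@filterS2 _ (0 : R)^' _ _ _ _ _ Dt' HA) => s Ds; exact.
Qed.

Lemma derivable_within_interior (R : realType) (D : set R) (f : R -> R) (t : R) :
  interior D t -> derivable_within D f t <-> derivable f t 1.
Proof.
move=> Dt; rewrite /derivable_within within_shift_interior// /derivable.
suff -> : (fun h : R => h^-1 *: ((f \o shift t) (h *: 1) - f t)) =
          (fun h : R => h^-1 *: (f (h + t) - f t)) by [].
by apply/funext => h /=; rewrite [_%:A]mulr1.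
Qed.

Lemma derive_within_interior (R : realType) (D : set R) (f : R -> R) (t : R) :
  interior D t -> derive_within D f t = derive1 f t.
Proof. by move=> Dt; rewrite /derive_within within_shift_interior. Qed.

Definition partial_t (R : realType) (D : set R) (f : R -> R -> R) (x t : R) : R :=
  derive_within D (f x) t.

(* f is of class C^k on B x D, for B open. Only the values of f on B x D
   matter: the iterated partial derivatives (relative to D in the second
   variable) exist at every point of B x D and are jointly continuous there. *)
Fixpoint class_C (R : realType) (k : nat) (B D : set R) (f : R -> R -> R) : Prop :=
  {within B `*` D, continuous (fun p : R * R => f p.1 p.2)} /\
  if k is k'.+1 then
    [/\ forall x t, B x -> D t ->
          derivable (f ^~ t) x 1 /\ derivable_within D (f x) t,
        class_C k' B D (partial1of2 f)
      & class_C k' B D (partial_t D f)]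
  else True.

Definition energy (R : realType) (B D : set R) (rho0 c : R) (f : R -> R -> R)
    (t : R) : R :=
  \int[lebesgue_measure]_(x in B)
    (2^-1 * (rho0 * partial_t D f x t ^+ 2 + c * partial1of2 f x t ^+ 2)).

(* Main.v *)
Require Import Defs.
From HB Require Import structures.
From mathcomp Require Import all_boot all_order all_algebra.
From mathcomp Require Import all_classical all_reals all_analysis.
From mathcomp Require Import ring lra.

(* With [p = I_t], [r = I_x], [v = I(., t) - I(., s)] and [u = r(., t) + r(., s)],
   the difference of the energy densities at times [t] and [s] is
   [rho0/2 (p(t) - p(s)) (p(t) + p(s)) + c/2 v_x u]. Since [v u] has compact
   support, [v_x u] may be replaced by [- v u_x], and the wave equation turns
   [c u_x] into [rho0 (I_tt(t) + I_tt(s))]. The remaining integrand is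
   [o(|t - s|)] uniformly by the mean value theorem in time and the uniform
   continuity of [I_t] and [I_tt], so the energy is constant. Only time increments
   are used: neither Schwarz's theorem on mixed partial derivatives nor
   differentiation under the integral sign is needed. *)

Set Implicit Arguments.
Unset Strict Implicit.
Unset Printing Implicit Defensive.

Import Order.TTheory GRing.Theory Num.Theory.
Import numFieldNormedType.Exports.

Local Open Scope classical_set_scope.
Local Open Scope ring_scope.

(** * Calculus and uniform estimates relative to a subset *)

Lemma within_continuous_precomp (T U V : topologicalType) (A : set T)
    (B : set U) (g : T -> U) (f : U -> V) :
  continuous g -> (forall x, A x -> B (g x)) ->
  {within B, continuous f} -> {within A, continuous (f \o g)}.
Proof.
move=> cg AB /subspace_continuousP cf; apply/subspace_continuousP => x Ax.
move=> W /(cf _ (AB _ Ax))/cg; rewrite /= /nbhs /= /within /=.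
by apply: filterS => y /= BW Ay; exact/BW/AB.
Qed.

Lemma within_continuousM (R : realType) (T : topologicalType) (A : set T)
    (f g : T -> R) :
  {within A, continuous f} -> {within A, continuous g} ->
  {within A, continuous (fun x => f x * g x)}.
Proof. by move=> cf cg x; apply: cvgM; [exact: cf|exact: cg]. Qed.

(** The classical mean value theorem differentiates only on []s, t[], whose points are interior to
    [D], so [derive_within] is the ordinary derivative there. At [s] and [t], which may be endpoints
    of [D], continuity suffices. *)
Lemma MVT_within (R : realType) (D : set R) (f : R -> R) (s t : R) :
  s < t -> `[s, t] `<=` D -> {within D, continuous f} ->
  (forall x, D x -> derivable_within D f x) ->
  exists2 y, y \in `[s, t] & f t - f s = derive_within D f y * (t - s).
Proof.
move=> st stD cf df.
have [//|x xst||y yst ->] := @MVT R f (derive_within D f) s t.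
- have intD : interior D x.
    have sub : `]s, t[ `<=` interior D.
      rewrite -open_subsetE; last exact: interval_open.
      by apply: subset_trans stD => y /subset_itv_oo_cc.
    exact: sub.
  have Dx := interior_subset intD.
  rewrite derive_within_interior// derive1E; apply: derivableP.
  exact: (derivable_within_interior f intD).1 (df x Dx).
- exact: continuous_subspaceW cf.
by exists y => //; apply: subset_itv_oo_cc.
Qed.

Lemma compact_within_bounded (R : realType) (T : topologicalType) (A : set T)
    (f : T -> R) : compact A -> {within A, continuous f} ->
  exists2 M, 0 < M & forall x, A x -> `|f x| <= M.
Proof.
move=> cA cf.
have /compact_bounded/ex_strict_bound_gt0[M M0 fM] := continuous_compact cf cA.
by exists M => // x Ax; apply/ltW/fM; exists x.
Qed.

Lemma compact_unif_continuous2 (R : realType) (A D : set R) (f : R -> R -> R) :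
  compact A -> compact D ->
  {within A `*` D, continuous (fun p : R * R => f p.1 p.2)} ->
  forall e, 0 < e -> exists2 d, 0 < d &
    forall x s t, A x -> D s -> D t -> `|s - t| < d -> `|f x s - f x t| < e.
Proof.
move=> cA cD /subspace_continuousP cf e e0.
(* Compactness as near covering: a property that holds locally for all small [d > 0] holds on the
   whole of [A x D] for one common [d]. *)
have /compact_near_coveringP/near_covering_withinP cov := compact_setX cA cD.
have H : \forall d \near 0^'+, A `*` D `<=` (fun p : R * R =>
    forall s, D s -> `|s - p.2| < d -> `|f p.1 s - f p.1 p.2| < e).
  apply: cov.
  move=> [x t] /= [Ax Dt].
  have /cvgrPdist_lt/(_ (e / 2))[|[U V]/= [xU tV] UVf] := cf (x, t) (conj Ax Dt).
    by rewrite divr_gt0.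
  move/nbhs_ballP: tV => [r /= r0 rV].
  (* Halving [r] leaves room for two moves: [u] is within [r / 2] of [t] and [s] within [d < r / 2]
     of [u], so both stay in [V], and each value is [e / 2]-close to [f x t]. *)
  exists (U `*` ball t (r / 2), [set d | d < r / 2]).
    split; last by apply: nbhs_right_lt; exact: divr_gt0.
    exists (U, ball t (r / 2)) => //; split => //=.
    by apply: nbhsx_ballx; rewrite divr_gt0.
  move=> [[y u] d] /= [[Uy tu] dr] [Ay Du] s Ds sud.
  rewrite /ball /= in tu.
  have Vs : V s.
    apply: rV; rewrite /ball /= (splitr r) (le_lt_trans (ler_distD u _ _))//.
    by rewrite ltrD// distrC (lt_trans sud).
  have Vu : V u.
    by apply: rV; rewrite /ball /= (lt_trans tu)// ltr_pdivrMr// ltr_pMr// ltr1n.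
  have yu := UVf (y, u) (conj Uy Vu) (conj Ay Du).
  have ys := UVf (y, s) (conj Uy Vs) (conj Ay Ds).
  rewrite (splitr e) (le_lt_trans (ler_distD (f x t) _ _))// ltrD//.
  by rewrite distrC.
near (0 : R)^'+ => d; exists d => // x s t Ax Ds Dt st.
exact: (near H d) (x, t) (conj Ax Dt) s Ds st.
Unshelve. all: by end_near. Qed.

(** Cut [[a, t]] into [n] equal steps shorter than [d]. With slope bound [e / (t - a)], the
    increments of [E] telescope to at most [e] in absolute value, for every [e > 0]. *)
Lemma locally_o_constant (R : realType) (E : R -> R) (a b : R) :
  (forall e, 0 < e -> exists2 d, 0 < d & forall s t,
     s \in `[a, b] -> t \in `[a, b] -> s < t -> t - s < d ->
     `|E t - E s| <= e * (t - s)) ->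
  forall t, t \in `[a, b] -> E t = E a.
Proof.
move=> HE t; rewrite in_itv/= => /andP[at_ tb].
have [->//|tNa] := eqVneq t a.
have lt_at : a < t by rewrite lt_neqAle eq_sym tNa.
apply/eqP; rewrite -subr_eq0 -normr_le0; apply/ler_addgt0Pr => e e0.
rewrite add0r.
have [|d d0 Ed] := HE (e / (t - a)); first by rewrite divr_gt0// subr_gt0.
have [n tan] : exists n, (t - a) / d < n%:R.
  exists (Num.bound ((t - a) / d)); apply: archi_boundP.
  by rewrite ltW// divr_gt0// subr_gt0.
have n0 : (0 < n%:R :> R) by rewrite (le_lt_trans _ tan)// ltW// divr_gt0// subr_gt0.
pose u k := a + k%:R * ((t - a) / n%:R).
have uS k : u k.+1 - u k = (t - a) / n%:R by rewrite /u -natr1; ring.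
have uab k : (k <= n)%N -> u k \in `[a, b].
  move=> kn; rewrite in_itv/= /u lerDl mulr_ge0 ?divr_ge0 ?subr_ge0 ?(ltW lt_at)//=.
  rewrite (le_trans _ tb)// -lerBrDl mulrCA ger_pMr ?subr_gt0//.
  by rewrite ler_pdivrMr// mul1r ler_nat.
have -> : E t - E a = \sum_(0 <= k < n) (E (u k.+1) - E (u k)).
  rewrite (telescope_sumr (E \o u))//= /u mul0r addr0 mulrCA divff ?gt_eqF//.
  by rewrite mulr1 subrKC.
rewrite (le_trans (ler_norm_sum _ _ _))//.
rewrite (le_trans (y := \sum_(0 <= k < n) (e / n%:R)))//.
  rewrite !big_nat; apply: ler_sum => k /= kn.
  rewrite (le_trans (Ed _ _ (uab _ (ltnW kn)) (uab _ kn) _ _))//.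
  - by rewrite -subr_gt0 uS divr_gt0// subr_gt0.
  - by rewrite uS ltr_pdivrMr// mulrC -ltr_pdivrMr.
  - by rewrite uS mulrA divfK// subr_eq0.
by rewrite sumr_const_nat subn0 -[leLHS]mulr_natr divfK ?gt_eqF.
Qed.

(** The mean value theorem turns [g t - g s] into [p x * (t - s)] and [p t - p s] into
    [q y * (t - s)]. What remains is [t - s] times the sum over [z = t, s] of [p z * q y - p x * q z
    = p z * (q y - q z) + (p z - p x) * q z], each term at most [2 * M * e]. *)
Lemma energy_remainder_bound (R : realType) (D : set R) (g : R -> R)
    (p := derive_within D g) (q := derive_within D p) (s t M e : R) :
  s < t -> `[s, t] `<=` D ->
  {within D, continuous g} -> {within D, continuous p} ->
  (forall x, D x -> derivable_within D g x) ->
  (forall x, D x -> derivable_within D p x) ->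
  (forall x, D x -> `|p x| <= M /\ `|q x| <= M) ->
  (forall x y, x \in `[s, t] -> y \in `[s, t] ->
    `|p x - p y| <= e /\ `|q x - q y| <= e) ->
  `|(p t - p s) * (p t + p s) - (g t - g s) * (q t + q s)|
    <= 4 * M * e * (t - s).
Proof.
move=> st stD cg cp dg dp bM ose.
have [x xst ->] := MVT_within st stD cg dg.
have [y yst ->] := MVT_within st stD cp dp.
rewrite -/p -/q.
have ts0 : 0 <= t - s by rewrite subr_ge0 ltW.
have sst : s \in `[s, t] by rewrite in_itv/= lexx ltW.
have tst : t \in `[s, t] by rewrite in_itv/= lexx ltW.
have bnd z : z \in `[s, t] -> `|p z * (q y - q z) + (p z - p x) * q z| <= M * e + e * M.
  move=> zst; rewrite (le_trans (ler_normD _ _))// !normrM.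
  have [pM qM] := bM z (stD z zst).
  have [_ oq] := ose y z yst zst; have [op _] := ose z x zst xst.
  by rewrite lerD// ler_pM.
rewrite (_ : _ - _ = ((p t * (q y - q t) + (p t - p x) * q t) +
  (p s * (q y - q s) + (p s - p x) * q s)) * (t - s)); last by ring.
rewrite normrM (ger0_norm ts0) ler_wpM2r// (le_trans (ler_normD _ _))//.
rewrite (le_trans (lerD (bnd _ tst) (bnd _ sst)))// le_eqVlt; apply/orP; left.
by apply/eqP; ring.
Qed.

(** * Vanishing outside the support, and integration by parts *)

Lemma derive_within_eq0 (R : realType) (a b : R) (f : R -> R) (t : R) :
  a < b -> t \in `[a, b] -> (forall s, s \in `[a, b] -> f s = 0) ->
  derive_within `[a, b] f t = 0.
Proof.
move=> ab tab f0; rewrite /derive_within.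
set F := within _ _.
(* Properness makes the limit along [F] unique. Since [a < b], arbitrarily small nonzero increments
   stay in [[a, b]]: to the right if [t < b], to the left if [t = b]. *)
have FF : ProperFilter F.
  apply: Build_ProperFilter_ex => A /nbhs_ballP[e /= e0 eA].
  have [h [he h0 hab]] : exists h, [/\ `|h| < e, h != 0 & h + t \in `[a, b]].
    move: (tab); rewrite in_itv/= => /andP[at_ tb].
    have [tltb|] := ltP t b.
      exists (Num.min (e / 2) (b - t)).
      have h0 : 0 < Num.min (e / 2) (b - t) by rewrite lt_min divr_gt0//= subr_gt0.
      split; [|by rewrite gt_eqF|].
        by rewrite gtr0_norm// gt_min ltr_pdivrMr// ltr_pMr// ltr1n.
      rewrite in_itv/= -lerBrDr ge_min lexx orbT andbT.
      by rewrite (le_trans at_)// lerDr ltW.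
    move=> bt; have {bt tb}-> : t = b by apply/eqP; rewrite eq_le tb.
    exists (- Num.min (e / 2) (b - a)).
    have h0 : 0 < Num.min (e / 2) (b - a) by rewrite lt_min divr_gt0//= subr_gt0.
    split; [|by rewrite oppr_eq0 gt_eqF|].
      by rewrite normrN gtr0_norm// gt_min ltr_pdivrMr// ltr_pMr// ltr1n.
    rewrite in_itv/= addrC lerBrDr -lerBrDl ge_min lexx orbT/=.
    by rewrite gerBl ltW.
  by exists h; apply: eA; rewrite ?/ball//= sub0r normrN.
apply: cvg_lim => //; apply: cvg_near_cst.
have : F [set h | h + t \in `[a, b]] by exact: withinT.
by apply: filterS => h /= hab; rewrite !f0// subrr scaler0.
Qed.

Lemma partial1of2_eq0 (R : realType) (U : set R) (f : R -> R -> R) (x t : R) :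
  open U -> U x -> (forall y, U y -> f y t = 0) -> partial1of2 f x t = 0.
Proof.
move=> oU Ux f0; rewrite partial1of2E -(derive_cst (0 : R) x 1).
apply: near_eq_derive; near=> y; apply: f0; near: y; exact: open_nbhs_nbhs.
Unshelve. all: by end_near. Qed.

(** Take the midpoints between [a] and the minimum of [K], and between the maximum of [K] and [b].
    This provides a compact interval inside []a, b[] whose endpoints lie off [K]. *)
Lemma compact_sub_itv_oo (R : realType) (a b : R) (K : set R) :
  a < b -> compact K -> K `<=` `]a, b[ ->
  exists a' b', [/\ a < a', a' < b', b' < b & K `<=` `]a', b'[].
Proof.
move=> ab cK Kab.
have [->|K0] := eqVneq K set0.
  exists (a + (b - a) / 3), (b - (b - a) / 3); split => //; lra.
move/set0P: K0 => K0.
have cid : {within K, continuous (id : R -> R)}.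
  by apply: continuous_subspaceT => x; exact: cvg_id.
have [k2 Kk2 maxk] := compact_EVT_max K0 cK cid.
have [k1 Kk1 mink] := compact_EVT_min K0 cK cid.
have := Kab _ (set_mem Kk1); have := Kab _ (set_mem Kk2).
rewrite /= !in_itv/= => /andP[ak2 k2b] /andP[ak1 k1b].
have k12 : k1 <= k2 by exact: mink.
exists ((a + k1) / 2), ((k2 + b) / 2); split; [lra..|].
move=> x Kx /=; rewrite in_itv/=.
have := mink x (mem_set Kx); have := maxk x (mem_set Kx).
by move=> /= xk2 k1x; apply/andP; split; lra.
Qed.

Lemma Rintegral_derive1_eq0 (R : realType) (a b : R) (F f : R -> R) :
  a < b -> (forall x, x \in `[a, b] -> is_derive x 1 F (f x)) ->
  {within `[a, b], continuous f} -> F a = F b ->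
  \int[lebesgue_measure]_(x in `[a, b]) f x = 0.
Proof.
move=> ab dF cf Fab.
have cF : {within `[a, b], continuous F}.
  apply: derivable_within_continuous => x xab.
  by have [] := dF x xab.
have [_ cFa cFb] := (continuous_within_itvP F ab).1 cF.
rewrite /Rintegral (@continuous_FTC2 _ f F)//.
- by rewrite Fab subee.
- split => // x /subset_itv_oo_cc xab; by have [] := dF x xab.
- by move=> x /subset_itv_oo_cc xab; rewrite derive1E; have [] := dF x xab.
Qed.

Lemma normrB_itv_le (R : realDomainType) (s t x y : R) :
  x \in `[s, t] -> y \in `[s, t] -> `|x - y| <= t - s.
Proof.
rewrite !in_itv/= => /andP[sx xt] /andP[sy yt].
by rewrite ler_norml opprB !lerB.
Qed.

(** The letters [u], [p], [q], [r], [w] stand for the values of I, I_t, I_tt, I_x, I_xx at one point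
    [x], at the times [t] and [s]; the two hypotheses are the wave equation. *)
Lemma energy_density_increment (R : numFieldType)
    (rho0 c ut us pt ps qt qs rt rs wt ws : R) :
  c * wt = rho0 * qt -> c * ws = rho0 * qs ->
  rho0 / 2 * ((pt - ps) * (pt + ps) - (ut - us) * (qt + qs)) =
  2^-1 * (rho0 * pt ^+ 2 + c * rt ^+ 2) - 2^-1 * (rho0 * ps ^+ 2 + c * rs ^+ 2)
  - c / 2 * ((rt - rs) * (rt + rs) + (ut - us) * (wt + ws)).
Proof.
move=> wqt wqs.
(* Regrouping so that [qt] and [qs] occur only multiplied by [rho0] lets the wave equation be
   substituted without dividing. *)
transitivity (rho0 / 2 * ((pt - ps) * (pt + ps))
  - 2^-1 * (ut - us) * (rho0 * qt + rho0 * qs)); first by ring.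
by rewrite -wqt -wqs; ring.
Qed.

(** * Conservation of the energy *)

Theorem corollary1 (R : realType) (a1 a2 tau rho0 c : R) (I : R -> R -> R)
  (tau_gt0 : 0 < tau) (rho0_gt0 : 0 < rho0)
  (I_C2 : class_C 2 `]a1, a2[ `[0, tau] I)
  (I_wave : forall x t : R, x \in `]a1, a2[ -> t \in `[0, tau] ->
     partial_t `[0, tau] (partial_t `[0, tau] I) x t
     - c / rho0 * partial1of2 (partial1of2 I) x t = 0)
  (I_supp : exists K : set R, [/\ compact K, K `<=` `]a1, a2[
     & forall x t : R, x \in `]a1, a2[ -> ~ K x -> t \in `[0, tau] -> I x t = 0]) :
  forall t : R, t \in `[0, tau] ->
    energy `]a1, a2[ `[0, tau] rho0 c I t = energy `]a1, a2[ `[0, tau] rho0 c I 0.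
Proof.
(* If [a2 <= a1] the body is empty and every energy is 0. *)
have [a21|a12] := leP a2 a1.
  have B0 : [set` `]a1, a2[] = set0 by rewrite set_itv_ge// bnd_simp -leNgt.
  by move=> t _; rewrite /energy B0 !Rintegral_set0.
case: I_supp => K [cK KB I0].
have [b1 [b2 [ab1 b12 ba2 Kb]]] := compact_sub_itv_oo a12 cK KB.
set B := [set` `]a1, a2[]; set D := [set` `[0, tau]].
set A := [set` `[b1, b2]].
have AB : A `<=` B.
  by move=> x; rewrite /A/B /= !in_itv/= => /andP[? ?]; apply/andP; split; lra.
have cA : compact A by exact: segment_compact.
have cD : compact D by exact: segment_compact.
have ADBD : A `*` D `<=` B `*` D by move=> [x t] [/AB].
move: I_C2 => [cI [dI [cIx [dIx [cIxx _] _]] [cIt [dIt _ [cItt _]]]]].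
set p := partial_t D I in cIt dIt cItt.
set q := partial_t D p in cItt.
set r := partial1of2 I in cIx dIx cIxx.
set w := partial1of2 r in cIxx.
have wave x t : B x -> D t -> c * w x t = rho0 * q x t.
  move=> Bx Dt; have /eqP := I_wave x t Bx Dt; rewrite subr_eq0 => /eqP.
  rewrite -/D -/p -/q -/r -/w => ->.
  by rewrite mulrA mulrCA divff ?gt_eqF// mulr1.
have slicex (f : R -> R -> R) t :
    D t -> {within B `*` D, continuous (fun z : R * R => f z.1 z.2)} ->
    {within A, continuous (f ^~ t)}.
  move=> Dt; apply: (@within_continuous_precomp _ _ _ A (B `*` D) (fun x => (x, t))
    (fun z => f z.1 z.2)).
    move=> x; apply: (cvg_pair (G := nbhs x) (H := nbhs t));
      [exact: cvg_id|exact: cvg_cst].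
  by move=> x /AB Bx; split.
have slicet (f : R -> R -> R) x :
    B x -> {within B `*` D, continuous (fun z : R * R => f z.1 z.2)} ->
    {within D, continuous (f x)}.
  move=> Bx; apply: (@within_continuous_precomp _ _ _ D (B `*` D) (fun t => (x, t))
    (fun z => f z.1 z.2)).
    move=> t; apply: (cvg_pair (G := nbhs x) (H := nbhs t));
      [exact: cvg_cst|exact: cvg_id].
  by move=> t Dt; split.
have ccst k : {within A, continuous (fun=> k : R)}.
  by apply: continuous_subspaceT => x; exact: cvg_cst.
pose e t x := 2^-1 * (rho0 * p x t ^+ 2 + c * r x t ^+ 2).
have ce t : D t -> {within A, continuous (e t)}.
  move=> Dt; have cp := slicex p t Dt cIt; have cr := slicex r t Dt cIx.
  have cp2 := within_continuousM (ccst rho0) (within_continuousM cp cp).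
  have cr2 := within_continuousM (ccst c) (within_continuousM cr cr).
  exact: within_continuousM (ccst 2^-1) (within_continuousD cp2 cr2).
(* The density vanishes on [B] outside [A]: there I(x, .) is zero on [D], and I(., t) is zero on the
   open set [B] minus [K]. The compact [A] then gives bounds, integrability and uniform
   continuity. *)
have energyE t : D t -> energy B D rho0 c I t = \int[lebesgue_measure]_(x in A) e t x.
  move=> Dt; rewrite /energy Rintegral_mkcond [RHS]Rintegral_mkcond.
  congr Rintegral; apply/funext => x; rewrite !patchE.
  have [xA|xA] := boolP (x \in A).
    by rewrite (mem_set (AB _ (set_mem xA))).
  case: ifPn => // /set_mem Bx.
  have nKx : ~ K x.
    move=> /Kb Kx; move/negP: xA; apply; apply/mem_set; exact: subset_itv_oo_cc.
  rewrite -/p -/r /p /r /partial_t (derive_within_eq0 tau_gt0)//; last first.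
    by move=> s Ds; exact: I0.
  rewrite (@partial1of2_eq0 _ (B `&` ~` K))//.
  - by rewrite expr0n/= !mulr0 addr0 mulr0.
  - apply: openI; first exact: interval_open.
    by rewrite openC; apply: compact_closed.
  - by move=> y [By nKy]; exact: I0.
have [M1 M10 pM] :=
  compact_within_bounded (compact_setX cA cD) (continuous_subspaceW ADBD cIt).
have [M2 M20 qM] :=
  compact_within_bounded (compact_setX cA cD) (continuous_subspaceW ADBD cItt).
pose M := Num.max M1 M2.
have M0 : 0 < M by rewrite lt_max M10.
apply: (@locally_o_constant _ (energy B D rho0 c I)) => eps eps0.
(* Chosen so that the final bound [rho0 / 2 * (4 * M * h * (t - s)) * (b2 - b1)] equals
   [eps * (t - s)]. *)
pose h := eps / (2 * rho0 * M * (b2 - b1)).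
have h0 : 0 < h by rewrite divr_gt0// !mulr_gt0// subr_gt0.
have [d1 d10 ucp] := compact_unif_continuous2 cA cD (continuous_subspaceW ADBD cIt) h0.
have [d2 d20 ucq] := compact_unif_continuous2 cA cD (continuous_subspaceW ADBD cItt) h0.
exists (Num.min d1 d2); first by rewrite lt_min d10.
move=> s t sD tD st; rewrite lt_min => /andP[td1 td2].
have stD : `[s, t] `<=` D.
  move=> z; rewrite /D/= !in_itv/= => /andP[sz zt].
  move: sD tD; rewrite !in_itv/= => /andP[s0 _] /andP[_ tt].
  by rewrite (le_trans s0)//= (le_trans zt).
(* [F] is the product v u, [f] its derivative in [x], and [W] the remainder left after the wave
   equation is used. *)
pose F x := (I x t - I x s) * (r x t + r x s).
pose f x := (r x t - r x s) * (r x t + r x s) + (I x t - I x s) * (w x t + w x s).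
pose W x := (p x t - p x s) * (p x t + p x s) - (I x t - I x s) * (q x t + q x s).
have cf : {within A, continuous f}.
  have cr1 := slicex r t tD cIx; have cr2 := slicex r s sD cIx.
  have cI1 := slicex I t tD cI; have cI2 := slicex I s sD cI.
  have cw1 := slicex w t tD cIxx; have cw2 := slicex w s sD cIxx.
  exact: within_continuousD
    (within_continuousM (within_continuousB cr1 cr2) (within_continuousD cr1 cr2))
    (within_continuousM (within_continuousB cI1 cI2) (within_continuousD cw1 cw2)).
(* The boundary terms vanish because [b1] and [b2] lie off [K], where [F] is zero. *)
have f_int0 : \int[lebesgue_measure]_(x in A) f x = 0.
  apply: (@Rintegral_derive1_eq0 _ _ _ F) => //.
    move=> x /AB Bx.
    have dIu u : D u -> is_derive x 1 (I ^~ u) (r x u).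
      by move=> Du; apply: DeriveDef; [exact: (dI x u Bx Du).1|rewrite /r partial1of2E].
    have dru u : D u -> is_derive x 1 (r ^~ u) (w x u).
      by move=> Du; apply: DeriveDef; [exact: (dIx x u Bx Du).1|rewrite /w partial1of2E].
    apply: (is_derive_eq (is_deriveM (is_deriveB (dIu t tD) (dIu s sD))
      (is_deriveD (dru t tD) (dru s sD)))).
    by rewrite /f addrC; congr (_ + _); rewrite mulrC.
  have F0 x : A x -> ~ K x -> F x = 0.
    by move=> /AB Bx nKx; rewrite /F !I0// subrr mul0r.
  rewrite !F0//.
  - by rewrite /A /= in_itv/= lexx ltW.
  - by move/Kb; rewrite /= in_itv/= ltxx andbF.
  - by rewrite /A /= in_itv/= lexx ltW.
  - by move/Kb; rewrite /= in_itv/= ltxx.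
have WE x : A x -> rho0 / 2 * W x = e t x - e s x - c / 2 * f x.
  move=> /AB Bx.
  exact: energy_density_increment (wave x t Bx tD) (wave x s Bx sD).
(* [M] and [h] come from compactness of [A x D], so the bound is uniform in [x] and can be
   integrated. *)
have W_bound x : A x -> `|W x| <= 4 * M * h * (t - s).
  move=> Ax; have Bx := AB _ Ax.
  have zD z : z \in `[s, t] -> D z by exact: stD.
  apply: (@energy_remainder_bound _ D (I x)) => //.
  - exact: slicet cI.
  - exact: slicet cIt.
  - by move=> z Dz; exact: (dI x z Bx Dz).2.
  - by move=> z Dz; exact: (dIt x z Bx Dz).2.
  - move=> z Dz; rewrite !le_max (pM (x, z) (conj Ax Dz)).
    by rewrite (qM (x, z) (conj Ax Dz)) orbT.
  - move=> y z yst zst; have yz := normrB_itv_le yst zst.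
    split; apply: ltW; [apply: ucp|apply: ucq] => //; try exact: zD.
    + exact: le_lt_trans td1.
    + exact: le_lt_trans td2.
rewrite !energyE//.
have ie u : D u -> lebesgue_measure.-integrable A (EFin \o e u).
  by move=> Du; apply: continuous_compact_integrable => //; exact: ce.
have int_f : lebesgue_measure.-integrable A (EFin \o f).
  exact: continuous_compact_integrable.
have mA : measurable (A : set (measurableTypeR R)) by exact: measurable_itv.
have ccf := within_continuousM (ccst (c / 2)) cf.
have cets := within_continuousB (ce t tD) (ce s sD).
have int_cf : lebesgue_measure.-integrable A (EFin \o (fun x => c / 2 * f x)).
  exact: continuous_compact_integrable.
have int_W : lebesgue_measure.-integrable A
    (EFin \o (fun x => e t x - e s x - c / 2 * f x)).
  exact: (continuous_compact_integrable cA (within_continuousB cets ccf)).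
(* Subtracting [c / 2 * f] leaves the integral unchanged, since [f] integrates to 0, and makes the
   integrand [rho0 / 2 * W]. *)
have -> : \int[lebesgue_measure]_(x in A) e t x -
    \int[lebesgue_measure]_(x in A) e s x =
    \int[lebesgue_measure]_(x in A) (e t x - e s x - c / 2 * f x).
  have int_e : lebesgue_measure.-integrable A (EFin \o (fun x => e t x - e s x)).
    exact: (continuous_compact_integrable cA cets).
  rewrite (RintegralB mA int_e int_cf) (RintegralB mA (ie t tD) (ie s sD)).
  by rewrite (RintegralZl _ mA int_f) f_int0 mulr0 subr0.
rewrite (le_trans (le_normr_Rintegral mA int_W))//.
rewrite (le_trans
  (y := \int[lebesgue_measure]_(x in A) (rho0 / 2 * (4 * M * h * (t - s)))))//.
  apply: le_Rintegral => //.
  - exact: integrable_abse int_W.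
  - exact: (continuous_compact_integrable cA (ccst _)).
  - move=> x Ax; rewrite -WE// normrM ger0_norm ?divr_ge0 ?(ltW rho0_gt0)//.
    by rewrite ler_wpM2l ?divr_ge0 ?(ltW rho0_gt0)// W_bound.
have muA : fine (lebesgue_measure A) = b2 - b1.
  by rewrite /A lebesgue_measure_itv/= lte_fin b12.
rewrite (Rintegral_cst _ mA) muA /h le_eqVlt; apply/orP; left.
apply/eqP; field.
by rewrite !gt_eqF// subr_gt0.
Qed.
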